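(* Assume $q > 2$. Let $P$ be a monic prime in $A = \mathbb{F}_q[T]$ and $\alpha \in \mathbb{F}_q^{\times}$, and suppose that $M_P = \alpha C_P(1)$ is a prime in $A$. Let $\beta \in \mathbb{F}_q^\times$ be the leading coefficient of $M_P$ and let $\wp$ be the monic prime with $M_P = \beta \wp$. Then $M_P$ is a non-Wieferich prime, i.e., $C_{\wp - 1}(1) \not\equiv 0 \pmod{\wp^2}$.
   Context: $q$ is a power of a prime, $A = \mathbb{F}_q[T]$. The Carlitz module is the unique $\mathbb{F}_q$-algebra homomorphism $a \mapsto C_a$ from $A$ to the ring of $\mathbb{F}_q$-linear polynomials in $A[x]$ (composition as multiplication) with $C_T(x) = Tx + x^q$; $C_a(1)$ is the value of $C_a(x)$ at $x=1$. A prime $\pi$ of $A$ with leading coefficient $\beta$ and monic associate $\wp = \beta^{-1}\pi$ is called a Wieferich prime if $C_{\wp-1}(1) \equiv 0 \pmod{\wp^2}$, and a non-Wieferich prime otherwise. *)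

(* Defs.v *)
From mathcomp Require Import all_boot all_order all_algebra all_field.

Set Implicit Arguments.
Unset Strict Implicit.
Unset Printing Implicit Defensive.

Import GRing.Theory.
Local Open Scope ring_scope.

(* The finite field F plays the role of F_q, with q = #|F|.  A = F_q[T] is
   {poly F}, with T written 'X : {poly F}; A[x] is {poly {poly F}}, with x
   written 'X : {poly {poly F}}. *)

Definition carlitzT (F : finFieldType) : {poly {poly F}} :=
  ('X : {poly F}) *: 'X + 'X^#|F|.

Definition carlitzTn (F : finFieldType) (n : nat) : {poly {poly F}} :=
  iter n (fun f => carlitzT F \Po f) 'X.

Definition carlitz (F : finFieldType) (a : {poly F}) : {poly {poly F}} :=
  \sum_(i < size a) (a`_i)%:P *: carlitzTn F i.

Definition wieferich_prime (F : finFieldType) (pi : {poly F}) : Prop :=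
  let wp := (lead_coef pi)^-1 *: pi in
  irreducible_poly pi /\ wp ^+ 2 %| (carlitz (wp - 1)).[1].

Definition non_wieferich_prime (F : finFieldType) (pi : {poly F}) : Prop :=
  irreducible_poly pi /\ ~ wieferich_prime pi.

(* carlitz is defined by an explicit formula; carlitz_is_module and
   carlitz_unique below show that it is the Carlitz module. *)

Definition fq_linear (F : finFieldType) (f : {poly {poly F}}) : Prop :=
  forall i, f`_i != 0 -> exists k, i = (#|F| ^ k)%N.

Record is_carlitz_module (F : finFieldType)
    (C : {poly F} -> {poly {poly F}}) : Prop := IsCarlitzModule {
  carlitz_module_linear : forall a, fq_linear (C a);
  carlitz_module_add : forall a b, C (a + b) = C a + C b;
  carlitz_module_scale : forall (c : F) a, C (c *: a) = c%:P *: C a;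
  carlitz_module_one : C 1 = 'X;
  carlitz_module_mul : forall a b, C (a * b) = C a \Po C b;
  carlitz_module_T : C 'X = carlitzT F
}.

Lemma exprD_card (F : finFieldType) (f g : {poly {poly F}}) :
  (f + g) ^+ #|F| = f ^+ #|F| + g ^+ #|F|.
Proof.
apply: exprDn_pchar; have [p p_pr pF] := finPcharP F.
rewrite (card_pprimeChar pF) pnatX pnatE // !pchar_poly pF.
by rewrite orTb.
Qed.

Lemma comp_carlitzT (F : finFieldType) (f : {poly {poly F}}) :
  carlitzT F \Po f = ('X : {poly F}) *: f + f ^+ #|F|.
Proof. by rewrite /carlitzT comp_polyD comp_polyZ rmorphXn /= comp_polyX. Qed.

Lemma comp_carlitzT_add (F : finFieldType) (f g : {poly {poly F}}) :
  carlitzT F \Po (f + g) = (carlitzT F \Po f) + (carlitzT F \Po g).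
Proof. by rewrite !comp_carlitzT exprD_card scalerDr addrACA. Qed.

Lemma comp_carlitzT0 (F : finFieldType) :
  carlitzT F \Po 0 = 0.
Proof.
rewrite comp_carlitzT scaler0 expr0n add0r.
by rewrite gtn_eqF // ltnW // card_finNzRing_gt1.
Qed.

Lemma comp_carlitzT_scale (F : finFieldType) (c : F) (f : {poly {poly F}}) :
  carlitzT F \Po (c%:P *: f) = c%:P *: (carlitzT F \Po f).
Proof.
rewrite !comp_carlitzT exprZn -polyC_exp expf_card scalerDr.
by rewrite !scalerA mulrC.
Qed.

Lemma carlitzE (F : finFieldType) (n : nat) (a : {poly F}) :
  (size a <= n)%N -> carlitz a = \sum_(i < n) (a`_i)%:P *: carlitzTn F i.
Proof.
move=> lean; rewrite /carlitz (big_ord_widen n (fun i => (a`_i)%:P *: _ i)) //.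
rewrite big_mkcond; apply: eq_bigr => i _; case: ltnP => // lei.
by rewrite nth_default // polyC0 scale0r.
Qed.

Lemma carlitzD (F : finFieldType) (a b : {poly F}) :
  carlitz (a + b) = carlitz a + carlitz b.
Proof.
have leD := size_polyD a b.
rewrite (carlitzE leD) (carlitzE (leq_maxl _ (size b))).
rewrite (carlitzE (leq_maxr (size a) _)) -big_split; apply: eq_bigr => i _ /=.
by rewrite coefD polyCD scalerDl.
Qed.

Lemma carlitzZ (F : finFieldType) (c : F) (a : {poly F}) :
  carlitz (c *: a) = c%:P *: carlitz a.
Proof.
rewrite (carlitzE (size_scale_leq c a)) /carlitz scaler_sumr.
by apply: eq_bigr => i _; rewrite coefZ polyCM scalerA.
Qed.

Lemma carlitz1 (F : finFieldType) : carlitz (1 : {poly F}) = 'X.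
Proof. by rewrite /carlitz size_poly1 big_ord1 coef1 scale1r. Qed.

Lemma carlitzXM (F : finFieldType) (a : {poly F}) :
  carlitz (a * 'X) = carlitzT F \Po carlitz a.
Proof.
have leX : (size (a * 'X)%R <= (size a).+1)%N.
  by rewrite (leq_trans (size_polyMleq _ _)) // size_polyX addn2.
rewrite (carlitzE leX) big_ord_recl coefMX scale0r add0r.
rewrite [in RHS]/carlitz.
rewrite (big_morph (fun f => carlitzT F \Po f) (@comp_carlitzT_add F)
  (@comp_carlitzT0 F)).
by apply: eq_bigr => i _; rewrite coefMX comp_carlitzT_scale.
Qed.

Lemma carlitzM (F : finFieldType) (a b : {poly F}) :
  carlitz (a * b) = carlitz a \Po carlitz b.
Proof.
elim/poly_ind: a => [|a c IHa].
  by rewrite mul0r /carlitz size_poly0 big_ord0 comp_poly0.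
rewrite mulrDl mul_polyC mulrAC carlitzD carlitzXM carlitzZ IHa.
rewrite carlitzD carlitzXM -alg_polyC carlitzZ carlitz1.
by rewrite comp_polyD comp_polyZ comp_polyX comp_polyA alg_polyC.
Qed.

Lemma carlitzX (F : finFieldType) : carlitz ('X : {poly F}) = carlitzT F.
Proof. by rewrite -['X]mul1r carlitzXM carlitz1 comp_polyXr. Qed.

Lemma fq_linearD (F : finFieldType) (f g : {poly {poly F}}) :
  fq_linear f -> fq_linear g -> fq_linear (f + g).
Proof.
move=> lf lg i; rewrite coefD; have [f0|/lf //] := eqVneq f`_i 0.
by rewrite f0 add0r; apply: lg.
Qed.

Lemma fq_linearZ (F : finFieldType) (a : {poly F}) (f : {poly {poly F}}) :
  fq_linear f -> fq_linear (a *: f).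
Proof.
move=> lf i; rewrite coefZ => af; apply: lf.
by apply: contraNneq af => ->; rewrite mulr0.
Qed.

Lemma fq_linear_exp (F : finFieldType) (f : {poly {poly F}}) :
  fq_linear f -> fq_linear (f ^+ #|F|).
Proof.
move=> lf i.
have e0 : (0 : {poly {poly F}}) ^+ #|F| = 0.
  by have := comp_carlitzT0 F; rewrite comp_carlitzT scaler0 add0r.
have -> : f ^+ #|F| =
    \sum_(j < size f) (f`_j ^+ #|F|) *: 'X^(j * #|F|).
  rewrite -[f in LHS]coefK poly_def (big_morph _ (@exprD_card F) e0).
  by apply: eq_bigr => j _; rewrite exprZn -exprM.
rewrite coef_sum => nz.
have [/existsP[j /andP[fj /eqP ->]]|no] :=
    boolP [exists j : 'I_(size f), (f`_j != 0) && (i == j * #|F|)%N].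
  by have [k ->] := lf _ fj; exists k.+1; rewrite expnSr.
case/eqP: nz; rewrite big1 // => j _; rewrite coefZ coefXn.
move: no; rewrite negb_exists => /forallP/(_ j).
rewrite negb_and negbK => /orP[/eqP->|/negPf->]; last by rewrite mulr0.
rewrite expr0n; suff -> : #|F| == 0%N = false by rewrite mul0r.
by rewrite gtn_eqF // ltnW // card_finNzRing_gt1.
Qed.

Lemma fq_linear_carlitz (F : finFieldType) (a : {poly F}) :
  fq_linear (carlitz a).
Proof.
have lX : fq_linear ('X : {poly {poly F}}).
  move=> i; rewrite coefX; have [->|_] := eqVneq i 1%N; first by exists 0%N.
  by rewrite eqxx.
elim/poly_ind: a => [|a c IHa].
  by rewrite /carlitz size_poly0 big_ord0 => i; rewrite coef0 eqxx.
rewrite carlitzD carlitzXM -alg_polyC carlitzZ carlitz1 comp_carlitzT.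
by apply: fq_linearD; [apply: fq_linearD; [|apply: fq_linear_exp]|];
   do ?apply: fq_linearZ.
Qed.

Lemma carlitz_is_module (F : finFieldType) : is_carlitz_module (@carlitz F).
Proof.
split; [exact: fq_linear_carlitz | exact: carlitzD | exact: carlitzZ
  | exact: carlitz1 | exact: carlitzM | exact: carlitzX].
Qed.

Lemma carlitz_unique (F : finFieldType) (C : {poly F} -> {poly {poly F}}) :
  is_carlitz_module C -> C =1 @carlitz F.
Proof.
move=> [_ CD CZ C1 CM CX]; elim/poly_ind => [|a c IHa].
  by rewrite -(scale0r 1) CZ carlitzZ !scale0r.
by rewrite CD carlitzD mulrC CM CX IHa mulrC carlitzXM -alg_polyC CZ carlitzZ
  C1 carlitz1.
Qed.

(* Main.v *)
(** Write C for the Carlitz module and y = C_P(1), an associate of wp.  If wp^2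
    divides C_(wp-1)(1), then P divides wp - 1: otherwise u P + v (wp - 1) = 1
    for some u, v, hence 1 = C_u(y) + C_v(C_(wp-1)(1)) is divisible by wp.
    Writing wp - 1 = b P, we get C_(wp-1)(1) = C_b(y) = b y mod wp^2, because
    C_b(x) = b x + (terms of degree at least q).  So wp divides b, hence wp - 1,
    which is absurd. *)
Require Import Defs.
From mathcomp Require Import all_boot all_order all_algebra all_field.

Import GRing.Theory.
Local Open Scope ring_scope.

(** By Horner induction: C_(aT+c)(y) = T C_a(y) + C_a(y)^q + c y. The terms in c cancel, and the
    q-th power vanishes modulo y^2 because y divides C_a(y) and q >= 2. *)
Lemma dvdp_sqr_carlitz_linear (F : finFieldType) (a y : {poly F}) :
  y ^+ 2 %| (carlitz a).[y] - a * y.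
Proof.
elim/poly_ind: a => [|a c IHa].
  by rewrite /carlitz size_poly0 big_ord0 horner0 mul0r subr0 dvdp0.
have y_dvd : y %| (carlitz a).[y].
  rewrite -(subrK (a * y) (carlitz a).[y]) dvdp_add ?dvdp_mull //.
  by apply: dvdp_trans IHa; rewrite dvdp_mulr.
rewrite carlitzD carlitzXM -alg_polyC carlitzZ carlitz1 comp_carlitzT alg_polyC.
rewrite !hornerE mulrDl opprD addrACA subrr addr0.
rewrite addrAC (mulrC a) -mulrA -mulrBr dvdp_add ?dvdp_mull //.
exact: dvdp_trans (dvdp_exp2r 2 y_dvd) (dvdp_exp2l _ (card_finNzRing_gt1 F)).
Qed.

(** C_a(x) has no constant term; this is read off the congruence C_a(y) = a y modulo y^2. *)
Lemma dvdp_carlitz (F : finFieldType) (d a y : {poly F}) :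
  d %| y -> d %| (carlitz a).[y].
Proof.
move=> d_dvd; rewrite -(subrK (a * y) (carlitz a).[y]) dvdp_add ?dvdp_mull //.
apply: dvdp_trans (dvdp_sqr_carlitz_linear _ a y).
by rewrite dvdp_mulr.
Qed.

Lemma irreducible_dvdp_carlitz1 (F : finFieldType) (d P a : {poly F}) :
    irreducible_poly P -> ~~ (d %| 1) ->
  d %| (carlitz P).[1] -> d %| (carlitz a).[1] -> P %| a.
Proof.
move=> P_irr d_nunit dP da; apply: contraR d_nunit => nPa.
have /Bezout_eq1_coprimepP[[u v] /= uv1] : coprimep P a.
  by rewrite irreducible_poly_coprime.
have {1}-> : 1 = (carlitz (u * P + v * a)).[1] by rewrite uv1 carlitz1 hornerX.
rewrite carlitzD !carlitzM !(hornerD, horner_comp).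
by apply: dvdp_add; apply: dvdp_carlitz.
Qed.

Theorem theorem3p3 (F : finFieldType) (q_gt2 : (2 < #|F|)%N)
    (P : {poly F}) (P_monic : P \is monic) (P_prime : irreducible_poly P)
    (alpha : F) (alpha_neq0 : alpha != 0)
    (M_P : {poly F}) (M_P_def : M_P = alpha *: (carlitz P).[1])
    (M_P_prime : irreducible_poly M_P)
    (beta : F) (beta_def : beta = lead_coef M_P)
    (wp : {poly F}) (wp_monic : wp \is monic) (wp_prime : irreducible_poly wp)
    (wp_def : M_P = beta *: wp) :
  non_wieferich_prime M_P /\ ~~ (wp ^+ 2 %| (carlitz (wp - 1)).[1]).
Proof.
have beta_neq0 : beta != 0.
  by rewrite beta_def lead_coef_eq0 irredp_neq0.
suff ndvd : ~~ (wp ^+ 2 %| (carlitz (wp - 1)).[1]).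
  split=> //; split=> // -[_].
  by rewrite -beta_def wp_def scalerA mulVf // scale1r; apply/negP.
have y_eqp : (carlitz P).[1] %= wp.
  have: alpha *: (carlitz P).[1] %= beta *: wp by rewrite -M_P_def wp_def eqpxx.
  rewrite (eqp_ltrans (eqp_scale _ alpha_neq0)).
  by rewrite (eqp_rtrans (eqp_scale _ beta_neq0)).
have wp_nunit : ~~ (wp %| 1).
  by rewrite dvdp1; case: wp_prime => + _; case: eqP => // ->.
apply/negP => wp2_dvd.
have /dvdpP[b wp1E] : P %| wp - 1.
  apply: (@irreducible_dvdp_carlitz1 _ wp) => //.
    by rewrite (eqp_dvdr _ y_eqp).
  by apply: dvdp_trans wp2_dvd; rewrite dvdp_mulr.
have wp_dvd_b : wp %| b.
  (* Multiplying by [wp], then trading it for its associate y on the right, turns the goal into: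
     wp^2 divides b y. This follows from C_b(y) = C_(bP)(1) = C_(wp-1)(1). *)
  rewrite -(dvdp_mul2r _ _ (irredp_neq0 wp_prime)) -expr2.
  rewrite -(eqp_dvdr _ (eqp_mull b y_eqp)).
  have := dvdp_sqr_carlitz_linear _ b (carlitz P).[1].
  rewrite (eqp_dvdl _ (eqp_exp 2 y_eqp)).
  rewrite -horner_comp -carlitzM -wp1E => lin.
  by rewrite -(dvdp_subr _ wp2_dvd).
case/negP: wp_nunit.
by rewrite -(dvdp_subr _ (dvdpp wp)) wp1E dvdp_mulr.
Qed.
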